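(* Let $\mathcal{F}_\varrho\subseteq[\omega_1]^{<\omega}$ be any family of finite subsets of $\omega_1$ such that its closure $\mathcal{K}_\varrho:=\overline{\mathcal{F}_\varrho}$ in $\mathcal{P}(\omega_1)$ satisfies: (i) $\{\alpha\}\in\mathcal{K}_\varrho$ for every $\alpha<\omega_1$; (ii) $[0,\alpha)\in\mathcal{K}_\varrho$ for every $\alpha\leq\omega_1$; (iii) if $A\in\mathcal{K}_\varrho$ is an infinite set, then $A=[0,\alpha)$ for some $\alpha\leq\omega_1$; (iv) $\mathcal{K}_\varrho$ is scattered. Then $\mathcal{K}_\varrho$ is a semi-Eberlein compact space and it admits a weak P-point.
   Context: $\omega_1$ is the first uncountable ordinal, $[\omega_1]^{<\omega}$ is the set of finite subsets of $\omega_1$, and $[0,\alpha)=\{\gamma\colon 0\leq\gamma<\alpha\}$. The power set $\mathcal{P}(\omega_1)$ is identified with $\{0,1\}^{\omega_1}$ via $A\leftrightarrow 1_A$ and carries the corresponding (compact) product topology; closures and topological properties refer to this topology. A topological space is scattered if each of its non-empty closed subspaces has an isolated point. A compact space is semi-Eberlein if, for some set $\Gamma$, it is homeomorphic to a compact set $\mathcal{K}\subseteq[0,1]^\Gamma$ (product topology) such that $\mathcal{K}\cap c_0(\Gamma)$ is dense in $\mathcal{K}$. A point $p$ of a topological space $X$ is a weak P-point if $p$ is not isolated and $p$ is not a limit point of any countable subset of $X\setminus\{p\}$. *)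

(* Defs.v *)
From HB Require Import structures.
From mathcomp Require Import all_boot all_order all_algebra.
From mathcomp Require Import all_classical all_reals all_analysis.
From mathcomp Require Import wochoice.

Set Implicit Arguments.
Unset Strict Implicit.
Unset Printing Implicit Defensive.

Import Order.TTheory GRing.Theory Num.Theory.
Import numFieldNormedType.Exports.

Local Open Scope classical_set_scope.
Local Open Scope ring_scope.

(* There is no library of ordinals: an ordered type W plays the role of omega_1
   when it is a well-order which is uncountable while each of its proper
   initial segments is countable. Its elements are then the ordinals
   alpha < omega_1, the interval [0, alpha) is [set g | g < alpha], and
   [0, omega_1) is [set: W]. *)
Definition is_omega1 d (W : orderType d) : Prop :=
  [/\ well_order (<=%O : rel W),
      ~ countable [set: W] &
      forall a : W, countable [set g : W | (g < a)%O]].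

Section GeneralTopology.

Definition homeomorphic (X Y : topologicalType) : Prop :=
  exists (f : X -> Y) (g : Y -> X),
    [/\ continuous f, continuous g, cancel f g & cancel g f].

Definition scattered (X : topologicalType) : Prop :=
  forall F : set X, closed F -> F !=set0 -> exists x, isolated F x.

Definition weak_P_point (X : topologicalType) (p : X) : Prop :=
  ~ isolated [set: X] p /\
  forall C : set X, C `<=` ~` [set p] -> countable C -> ~ limit_point C p.

End GeneralTopology.

Section SemiEberlein.
Variable R : realType.

Definition unit_cube (Gamma : Type) : set {ptws Gamma -> R} :=
  [set x | forall g, 0 <= x g <= 1].

Definition c0 (Gamma : Type) : set {ptws Gamma -> R} :=
  [set x | forall e : R, 0 < e -> finite_set [set g | e <= `|x g|]].

(* A set A of a topological space coerces to the type of its elements, which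
   carries the subspace topology. *)
Definition semi_Eberlein (X : topologicalType) : Prop :=
  compact [set: X] /\
  exists (Gamma : Type) (K : set {ptws Gamma -> R}),
    [/\ K `<=` @unit_cube Gamma,
        compact K,
        homeomorphic X (K : Type) &
        dense [set x : (K : Type) | c0 (set_val x)]].

End SemiEberlein.

(* The identification of the power set of T with {0, 1}^T. *)
Definition char_fun (T : Type) (A : set T) : {ptws T -> bool} :=
  fun x => x \in A.

Definition closed_family (T : Type) (F : set (set T)) : set {ptws T -> bool} :=
  closure (@char_fun T @` F).

(* Main.v *)
Require Import Defs.
From HB Require Import structures.
From mathcomp Require Import all_boot all_order all_algebra.
From mathcomp Require Import all_classical all_reals all_analysis.

(** Let [K] be the closure of a family of finite sets in the Cantor cube
[{0, 1}^W].

[K] is semi-Eberlein because the inclusion of [{0, 1}] into [[0, 1]] embeds it in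
the cube [[0, 1]^W]: the members of the family are mapped to functions of finite
support, which belong to [c_0], and they are dense in [K] by construction
([semi_Eberlein_closed_family]).

The weak P-point is [p = [0, omega_1)], that is, the constant function 1. An
isolated point of [K] meets the dense family, so it is a finite set
([isolated_closed_family]); as [W] is infinite, [p] is not isolated. By the
hypotheses on [K], every other point of [K] is either finite or a proper initial
segment of [omega_1], hence countable. The union of countably many of them is
therefore countable and misses some [t] in [W]; then [{x | x t = 1}] is a
neighbourhood of [p] which contains none of them
([not_limit_point_countable_supports]). *)

Set Implicit Arguments.
Unset Strict Implicit.
Unset Printing Implicit Defensive.

Import Order.TTheory GRing.Theory Num.Theory.
Import numFieldNormedType.Exports.

Local Open Scope classical_set_scope.
Local Open Scope ring_scope.


Lemma continuous_into_ptws (X : topologicalType) (I : Type)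
    (Y : topologicalType) (f : X -> {ptws I -> Y}) :
  (forall i, continuous (fun x => f x i)) -> continuous f.
Proof.
move=> cf x; apply/cvg_sup => i.
exact: (@continuous_comp_initial _ X Y (fun h : I -> Y => h i) f (cf i)).
Qed.

Lemma continuous_eval (T : eqType) (Y : topologicalType) (t : T) :
  continuous (fun x : {ptws T -> Y} => x t).
Proof. exact: (@proj_continuous T (fun=> Y) t). Qed.

Lemma continuous_into_set_type (X Y : topologicalType) (A : set Y)
    (f : X -> (A : Type)) :
  continuous (set_val \o f) -> continuous f.
Proof. exact: continuous_comp_initial. Qed.

(** [set_valP] restated with [set_val] in place of [\val], so that the equations
obtained by destructing it rewrite in statements about [set_val]. *)
Lemma in_set_val (T : Type) (A : set T) (x : (A : Type)) : A (set_val x).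
Proof. exact: set_valP. Qed.

Lemma continuous_set_val (X : topologicalType) (A : set X) :
  continuous (set_val : A -> X).
Proof. exact: initial_continuous. Qed.

Lemma nbhs_set_type (X : topologicalType) (A : set X) (x : (A : Type))
    (U : set (A : Type)) :
  nbhs x U -> exists2 V, nbhs (set_val x) V & set_val @^-1` V `<=` U.
Proof.
move=> -[_ [[V oV <-] /= Vx VU]]; exists V => //.
exact: open_nbhs_nbhs.
Qed.

(** Compactness does not depend on the ambient space: a filter on the subspace is
pushed forward along the inclusion, and its cluster points in [A] are cluster
points of the original filter. *)
Lemma compact_set_type (X : topologicalType) (A : set X) :
  compact A -> compact [set: (A : Type)].
Proof.
move=> cA F PF _.
have FA : (set_val @ F) A by apply: nearW => x; exact: in_set_val.
have [x [Ax clx]] := cA _ _ FA.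
exists (SigSub (mem_set Ax)); split => // B U FB.
move=> /nbhs_set_type[V Vx VU].
have FB' : (set_val @ F) (set_val @` B).
  by apply: (@filterS _ F _ B) => // y By; exists y.
by have [_ [[y By <-] Vy]] := clx _ _ FB' Vx; exists y; split => //; exact: VU.
Qed.

Lemma char_fun_support (T : Type) (x : {ptws T -> bool}) :
  char_fun [set t | x t] = x.
Proof.
by apply/funext => t; rewrite /char_fun; apply/idP/idP; rewrite in_setE.
Qed.

Lemma char_fun_inj (T : Type) : injective (@char_fun T).
Proof.
move=> A B AB; apply/seteqP; split=> t.
  by move=> /mem_set; rewrite -[_ \in _]/(char_fun A t) AB => /set_mem.
by move=> /mem_set; rewrite -[_ \in _]/(char_fun B t) -AB => /set_mem.
Qed.

Lemma compact_closed_family (T : eqType) (F : set (set T)) :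
  compact (closed_family F).
Proof.
apply: (@subclosed_compact _ _ [set: {ptws T -> bool}]) => //.
  exact: closed_closure.
have -> : [set: {ptws T -> bool}] =
    [set f | forall i, [set: bool] (f i)] by apply/seteqP.
by apply: (@tychonoff T (fun=> bool) (fun=> setT)) => _; exact: bool_compact.
Qed.

Section IndicatorEmbedding.
Variables (R : realType) (T : eqType).

Definition real_indicator (x : {ptws T -> bool}) : {ptws T -> R} :=
  fun t => (x t)%:R.

Lemma continuous_real_indicator : continuous real_indicator.
Proof.
apply: continuous_into_ptws => t x.
apply: (@continuous_comp _ _ _ (fun x : {ptws T -> bool} => x t)
  (fun b : bool => b%:R : R)).
  exact: continuous_eval.
move=> U /= /(@nbhs_singleton R) Ub.
by apply: (filterS _ (discrete_set1 (x t))) => b /= ->.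
Qed.

(** A left inverse of [real_indicator] defined on all of [R^T]; its restriction to
the image of [K] is the inverse homeomorphism. *)
Definition threshold (y : {ptws T -> R}) : {ptws T -> bool} :=
  fun t => 2^-1 < y t.

Lemma real_indicatorK : cancel real_indicator threshold.
Proof.
move=> x; apply/funext => t; rewrite /threshold /real_indicator.
case: (x t); first by rewrite invf_lt1 ?ltr1n ?ltr0n.
by apply/negbTE; rewrite -leNgt invr_ge0 ler0n.
Qed.

(** [threshold] is not continuous on the whole of [R^T], but its coordinates can
only jump at the value 1/2, which no indicator function takes. *)
Lemma threshold_locally_constant (x : {ptws T -> bool}) (t : T) :
  \forall z \near real_indicator x, threshold z t = x t.
Proof.
have ct := @continuous_eval T R t (real_indicator x).
rewrite /threshold; case xt: (x t).
  apply: (ct [set r | (2^-1 < r) = true]); apply: lt_nbhsr.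
  by rewrite /real_indicator xt invf_lt1 ?ltr1n ?ltr0n.
apply: (ct [set r | (2^-1 < r) = false]).
apply: (filterS _ (@lt_nbhsl R _ 2^-1 _)) => [r /ltW|].
  by rewrite leNgt => /negbTE.
by rewrite /real_indicator xt invr_gt0 ltr0n.
Qed.

Lemma homeomorphic_real_indicator (K : set {ptws T -> bool}) :
  homeomorphic (K : Type) (real_indicator @` K : Type).
Proof.
have fK (x : (K : Type)) : (real_indicator @` K) (real_indicator (set_val x)).
  by exists (set_val x) => //; exact: in_set_val.
have gK (y : (real_indicator @` K : Type)) : K (threshold (set_val y)).
  by have [x Kx <-] := in_set_val y; rewrite real_indicatorK.
exists (fun x => SigSub (mem_set (fK x))), (fun y => SigSub (mem_set (gK y))).
split.
- apply: continuous_into_set_type => x.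
  apply: (@continuous_comp _ _ _ set_val real_indicator).
    exact: continuous_set_val.
  exact: continuous_real_indicator.
- apply: continuous_into_set_type; apply: continuous_into_ptws => t y.
  apply/discrete_cvg; first by apply: fmap_filter; exact: nbhs_filter.
  have [x _ xy] := in_set_val y.
  have near_y : nbhs (set_val y)
      [set z | threshold z t = threshold (set_val y) t].
    by rewrite -xy real_indicatorK; exact: threshold_locally_constant.
  exact: (continuous_set_val near_y).
- by move=> x; apply/val_inj; rewrite /= real_indicatorK set_valE.
- move=> y; apply/val_inj.
  have [x _ xy] := in_set_val y.
  change (real_indicator (threshold (set_val y)) = set_val y).
  by rewrite -xy real_indicatorK.
Qed.

Lemma c0_real_indicator (A : set T) :
  finite_set A -> c0 (real_indicator (char_fun A)).
Proof.
move=> finA e e0; apply: sub_finite_set finA => t /=.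
rewrite /real_indicator /char_fun.
by case: (boolP (t \in A)) => [/set_mem //|_]; rewrite normr0 leNgt e0.
Qed.

Lemma semi_Eberlein_closed_family (F : set (set T)) :
  (forall A, F A -> finite_set A) ->
  semi_Eberlein R (closed_family F : Type).
Proof.
move=> finF; split; first exact/compact_set_type/compact_closed_family.
exists T, (real_indicator @` closed_family F); split.
- move=> _ [x _ <-] t; rewrite /real_indicator.
  by case: (x t); rewrite /= ?lexx ler01.
- apply: continuous_compact; last exact: compact_closed_family.
  exact/continuous_subspaceT/continuous_real_indicator.
- exact: homeomorphic_real_indicator.
- move=> O [y Oy] oO.
  have [V Vy VO] := nbhs_set_type (open_nbhs_nbhs (conj oO Oy)).
  have [x Fx xy] := in_set_val y; rewrite -xy in Vy.
  have [_ [[A FA <-] VA]] := Fx _ (continuous_real_indicator Vy).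
  have KA : (real_indicator @` closed_family F) (real_indicator (char_fun A)).
    by exists (char_fun A) => //; apply: subset_closure; exists A.
  exists (SigSub (mem_set KA)); split; first exact: VO.
  exact/c0_real_indicator/finF.
Qed.

End IndicatorEmbedding.

(** A dense subset contains all isolated points. *)
Lemma isolated_closed_family (T : Type) (F : set (set T))
    (x : (closed_family F : Type)) :
  isolated [set: (closed_family F : Type)] x ->
  exists2 A, F A & set_val x = char_fun A.
Proof.
move=> [_ [U + Ux]] => /nbhs_set_type[V Vx VU].
have [_ [[A FA <-] VA]] := in_set_val x _ Vx.
have KA : closed_family F (char_fun A).
  by apply: subset_closure; exists A.
exists A => //; have : (U `&` setT) (SigSub (mem_set KA)).
  by split => //; exact: VU.
by rewrite Ux => <-.
Qed.

(** The supports of the members of [C] have a countable union, so some coordinate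
[t] separates [p] from the whole of [C]. *)
Lemma not_limit_point_countable_supports (T : eqType)
    (K : set {ptws T -> bool}) (p : (K : Type)) (C : set (K : Type)) :
  ~ countable [set: T] -> (forall t, set_val p t) -> countable C ->
  (forall x, C x -> countable [set t | set_val x t]) -> ~ limit_point C p.
Proof.
move=> uT pT cC Csupp Cp.
have cS : countable (\bigcup_(x in C) [set t | set_val x t]).
  exact: bigcup_countable.
have [t St] : exists t, ~ (\bigcup_(x in C) [set t | set_val x t]) t.
  apply/not_existsP => allS; apply: uT; apply: sub_countable cS.
  apply: subset_card_le => t _; apply: contrapT; exact: allS.
have pt : nbhs (set_val p) [set z : {ptws T -> bool} | z t].
  apply: (@continuous_eval T bool t _ [set b | b]).
  by apply: filterS (discrete_set1 _) => b ->; exact: pT.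
have nt : nbhs p [set x : (K : Type) | set_val x t].
  exact: (continuous_set_val pt).
by have [x [_ Cx xt]] := Cp _ nt; apply: St; exists x.
Qed.

Theorem proposition4p11 (R : realType) (d : Order.disp_t) (W : orderType d)
  (omega1W : is_omega1 W)
  (F : set (set W))
  (finF : forall A, F A -> finite_set A)
  (singletons : forall a : W, closed_family F (char_fun [set a]))
  (segments : forall a : W,
    closed_family F (char_fun [set g : W | (g < a)%O]))
  (segment_omega1 : closed_family F (char_fun [set: W]))
  (infinite_segments : forall A : set W,
    closed_family F (char_fun A) -> infinite_set A ->
    (exists a : W, A = [set g : W | (g < a)%O]) \/ A = [set: W])
  (scatteredK : scattered (closed_family F : Type)) :
  semi_Eberlein R (closed_family F : Type) /\
  exists p : (closed_family F : Type), weak_P_point p.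
Proof.
have [_ uncountableW countable_initial] := omega1W.
split; first exact: semi_Eberlein_closed_family.
set p : (closed_family F : Type) := SigSub (mem_set segment_omega1).
have pE : set_val p = char_fun [set: W] by [].
exists p; split.
  move=> /isolated_closed_family[A FA]; rewrite pE => /char_fun_inj WA.
  by apply: uncountableW; rewrite WA; exact/finite_set_countable/finF.
move=> C Cp cC; apply: not_limit_point_countable_supports => // [t|x Cx].
  by rewrite pE; exact: mem_set.
have Kx : closed_family F (char_fun [set t | set_val x t]).
  by rewrite char_fun_support; exact: in_set_val.
have [fin|inf] := pselect (finite_set [set t | set_val x t]).
  exact: finite_set_countable.
have [[a ->]|suppW] := infinite_segments _ Kx inf.
  exact: countable_initial.
by case: (Cp x Cx); apply/val_inj; rewrite -set_valE pE -suppW char_fun_support.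
Qed.
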